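(* Let $(\Omega,\mu,d)$ be a metric measure space with $\Omega$ compact and $\mu(\Omega)<\infty$, and let $X=L^p(\Omega)$ with $1\le p\le\infty$, or $X=\mathcal C_b(\Omega)$. Let $J\ge0$ be a kernel, $K_Ju(x)=\int_\Omega J(x,y)u(y)\,dy$ and $h_0(x)=\int_\Omega J(x,y)\,dy$. Assume that $K_J\in\mathcal L(L^1(\Omega),\mathcal C_b(\Omega))$ is compact, $J\in L^\infty(\Omega,L^1(\Omega))$, $J(x,y)=J(y,x)$ and $$J(x,y)>0\quad\text{for all }x,y\in\Omega\text{ such that }d(x,y)<R,\quad\text{for some }R>0.$$ Assume also that $h_0(x)>\alpha>0$ for all $x\in\Omega$. Let $u_0\in X$. Then the solution $u$ of $$u_t(x,t)=(K_J-h_0I)u(x,t),\qquad u(x,0)=u_0(x),$$ satisfies $$\lim_{t\to\infty}\left\|e^{\beta t}\left(u(t)-\frac1{\mu(\Omega)}\int_\Omega u_0\right)\right\|_X=0$$ for some $\beta>0$.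
   Context: A metric measure space $(\Omega,\mu,d)$ is a metric space $(\Omega,d)$ with a $\sigma$-finite, regular, complete Borel measure $\mu$ that associates a finite positive measure to the balls of $\Omega$. Integration is with respect to $\mu$. $\mathcal C_b(\Omega)$ is the space of bounded continuous functions with the sup norm. $L^\infty(\Omega,L^1(\Omega))$ is the space of $L^1(\Omega)$-valued $L^\infty$ functions, with $J$ identified with $x\mapsto J(x,\cdot)$. The solution is $u(t)=e^{(K_J-h_0I)t}u_0$.
   Formalization: The formal theorem adds that any two points of Ω are joined by a finite chain of points with consecutive distances < R; without it the claim fails (two points at distance ≥ R, J the identity matrix, so u(t)=u_0). J is taken jointly measurable. *)

(* Defs.v *)
(* MathComp-Analysis. *)
From HB Require Import structures.
From mathcomp Require Import all_boot all_order all_algebra.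
From mathcomp Require Import all_classical all_reals all_analysis.
From mathcomp Require Import ess_sup_inf.

Set Implicit Arguments.
Unset Strict Implicit.
Unset Printing Implicit Defensive.
Import Order.TTheory GRing.Theory Num.Theory.
Import numFieldNormedType.Exports.

Local Open Scope classical_set_scope.
Local Open Scope ring_scope.

(* The library's measurable types are pointed, so the space is nonempty. *)
#[short(type="metricMeasurableType")]
HB.structure Definition MetricMeasurable (d : measure_display)
    (K : numDomainType) := {T of Measurable d T & Metric K T}.

Section metric_measure_space.
Context {d : measure_display} {R : realType} {Omega : metricMeasurableType d R}.
Variable mu : {measure set Omega -> \bar R}.
Local Open Scope ereal_scope.

(* The sigma-algebra is allowed to be larger than the Borel one, because a
   complete measure is in general not defined on Borel sets only. *)
Record metric_measure_space : Prop := MetricMeasureSpace {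
  borel_measurable : forall A : set Omega, open A -> measurable A ;
  mms_sigma_finite : sigma_finite [set: Omega] mu ;
  mms_complete : measure_is_complete mu ;
  outer_regular : forall A : set Omega, measurable A ->
    mu A = ereal_inf [set mu U | U in [set U | open U /\ A `<=` U]] ;
  inner_regular : forall A : set Omega, measurable A ->
    mu A = ereal_sup [set mu K | K in [set K | compact K /\ K `<=` A]] ;
  ball_measure : forall (x : Omega) (r : R), (0 < r)%R ->
    0 < mu (ball x r) < +oo }.

End metric_measure_space.

(* Any two points are joined by a finite chain of points with consecutive
   distances < r. A connected space is chain connected for every r > 0. If
   J(x, y) > 0 is only known for d(x, y) < r, this is what makes the constants
   the only null functions of K_J - h_0 I: on two points at distance >= r with
   J = 0 off the diagonal, that operator vanishes. *)
Definition chain_connected (R : realType) (Omega : metricType R) (r : R) : Prop :=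
  forall x y : Omega, exists s : seq Omega,
    path (fun a b => mdist a b < r) x s /\ last x s = y.

Inductive function_space (R : realType) : Type :=
  | Lp (p : \bar R) of (1 <= p)%E
  | Cb.
Arguments Cb {R}.

Section nonlocal_problem.
Context {d : measure_display} {R : realType} {Omega : metricMeasurableType d R}.
Variable mu : {measure set Omega -> \bar R}.
Implicit Types (X : function_space R) (f g : Omega -> R)
  (J : Omega -> Omega -> R).

(* Elements of L^p are handled through representatives; [fnorm] is then the
   norm of the class. *)
Definition in_space X f : Prop :=
  match X with
  | Lp p _ => f \in Lfun mu p
  | Cb => continuous f /\ exists M : R, forall x, `|f x| <= M
  end.

Definition fnorm X f : \bar R :=
  match X with
  | Lp p _ => 'N[mu]_p[EFin \o f]%E
  | Cb => ereal_sup [set `|f x|%:E | x in [set: Omega]]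
  end.

Definition KJ J f : Omega -> R := fun x => \int[mu]_y (J x y * f y).

Definition h0 J : Omega -> R := fun x => \int[mu]_y J x y.

(* K_J is a compact operator in L(L^1, C_b). [Rintegral] of a non-integrable
   function is a junk value, hence the explicit integrability; compactness is
   for the sup norm, i.e. the topology of uniform convergence. *)
Record KJ_compact_L1_Cb J : Prop := KJCompactL1Cb {
  KJ_defined : forall f, f \in Lfun mu 1%E ->
    forall x, mu.-integrable [set: Omega] (fun y => (J x y * f y)%:E) ;
  KJ_Cb : forall f, f \in Lfun mu 1%E -> in_space Cb (KJ J f) ;
  KJ_bounded : exists C : R, forall f, f \in Lfun mu 1%E ->
    (fnorm Cb (KJ J f) <= C%:E * 'N[mu]_1[EFin \o f])%E ;
  KJ_compact : precompact
    (KJ J @` [set f | f \in Lfun mu 1%E /\ ('N[mu]_1[EFin \o f] <= 1)%E]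
      : set {uniform Omega -> R}) }.

(* L^1(Omega)-valued simple functions. *)
Definition L1_simple (s : Omega -> Omega -> R) : Prop :=
  [/\ finite_set (range s),
      (forall g, measurable (s @^-1` [set g])) &
      (forall x, s x \in Lfun mu 1%E)].

(* x |-> J(x, .) is strongly measurable with values in L^1(Omega). *)
Definition L1_strongly_measurable J : Prop :=
  exists2 s : nat -> Omega -> Omega -> R, (forall n, L1_simple (s n)) &
    {ae mu, forall x,
      'N[mu]_1[EFin \o (fun y => (s n x y - J x y)%R)]%E @[n --> \oo] --> 0%E}.

Definition in_Linfty_L1 J : Prop :=
  [/\ (forall x, J x \in Lfun mu 1%E),
      L1_strongly_measurable J &
      (ess_sup mu (fun x => 'N[mu]_1[EFin \o J x]) < +oo)%E].

Definition nonlocal_op J f : Omega -> R := fun x => KJ J f x - h0 J x * f x.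

Definition exp_sum (A : (Omega -> R) -> Omega -> R) (t : R) (u0 : Omega -> R) (n : nat) :
    Omega -> R :=
  fun x => \sum_(0 <= k < n) t ^+ k / k`!%:R * iter k A u0 x.

(* u(t) = exp(t (K_J - h_0 I)) u0 for t >= 0, the exponential series being
   convergent in X. *)
Definition is_solution X J (u0 : Omega -> R) (u : R -> Omega -> R) : Prop :=
  forall t : R, 0 <= t -> in_space X (u t) /\
    fnorm X (fun x => u t x - exp_sum (nonlocal_op J) t u0 n x)
      @[n --> \oo] --> 0%E.

Definition mean f : R := (fine (mu [set: Omega]))^-1 * \int[mu]_y f y.

End nonlocal_problem.

(* Main.v *)
Require Import Defs.
From HB Require Import structures.
From mathcomp Require Import all_boot all_order all_algebra.
From mathcomp Require Import all_classical all_reals all_analysis.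
From mathcomp Require Import measurable_realfun ess_sup_inf.
From mathcomp Require Import ring lra.

Set Implicit Arguments.
Unset Strict Implicit.
Unset Printing Implicit Defensive.
Import Order.TTheory GRing.Theory Num.Theory.
Import numFieldNormedType.Exports.

Local Open Scope classical_set_scope.
Local Open Scope ring_scope.

(** Why the solution relaxes exponentially. Write K for K_J, let H be an upper
bound of h_0, and split the generator as K - h_0 = B - H with
B f = K f + (H - h_0) f. The operator B is positive, B 1 = H, and the symmetry
of J gives that B multiplies integrals by H. Constants are stationary, and
exp(t (K - h_0)) = exp(- t H) exp(t B), so it is enough to find rho < H such
that every f of zero mean satisfies |B^n f|_X <= D rho^n for some D: the solution then
approaches its mean like exp(- (H - rho) t).

The gain over the trivial rate H is a Doeblin minorization, [iterK_doeblin]: for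
some N and delta > 0, K^N f >= delta (integral of f) whenever f >= 0. This is
where compactness and chain connectedness enter. Compactness of K makes the
kernels of K^2, K^3 and so on equicontinuous in one variable uniformly in the
other; as these kernels are symmetric, they are jointly continuous. They are
positive on the diagonal, positivity spreads along chains of steps shorter than r, and a
positive continuous function on a compact space is bounded below. Since
B^N >= K^N on nonnegative functions, applying the minorization to |f| + f and
|f| - f gives |B^N f| <= B^N |f| - delta |f|_1 when f has zero mean, and
integration yields a contraction of B^N / H^N in L^1, [shifted_contraction].

The rate passes from L^1 to all the spaces X at once: K f is bounded in sup norm
by |f|_1, and multiplication by H - h_0 has norm at most H - alpha < H, so the
X-norms of B^n f satisfy a linear recursion of ratio less than H whose forcing
decays like rho^n, [shifted_rate_in_space].

The solution is defined by the exponential series of K - h_0. The binomial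
theorem rewrites its partial sums in terms of the B^n f, [exp_sum_nonlocalE];
the coefficients are partial sums of exp(- t H), and the total error made when
they are replaced by exp(- t H) is controlled by the scalar limit
[cvg_exp_cauchy_remainder]. *)

(** * Partial sums of the exponential and the binomial theorem *)

Section exponential_series.
Context {R : realType}.
Implicit Types (a b : nat -> R) (x y t : R).

(** If b j = B^j f, this is (B + y)^k f. *)
Definition binomial_transform y b k : R :=
  \sum_(0 <= j < k.+1) 'C(k, j)%:R * y ^+ (k - j) * b j.

(** The truncated form of exp(t (B + y)) = exp(t y) exp(t B): the summand of
index (j, i) with i + j = k is the same on both sides, and both sums run over the
triangle i + j < n. *)
Lemma exp_sum_binomial_transform t y b n :
  \sum_(0 <= k < n) t ^+ k / k`!%:R * binomial_transform y b k =
  \sum_(0 <= j < n) t ^+ j / j`!%:R * b j * series (exp_coeff (t * y)) (n - j)%N.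
Proof.
pose F j i : R := t ^+ j / j`!%:R * b j * exp_coeff (t * y) i.
transitivity (\sum_(0 <= k < n) \sum_(0 <= j < k.+1) F j (k - j)%N).
  apply: eq_bigr => k _; rewrite /binomial_transform mulr_sumr !big_nat.
  apply: eq_bigr => j /andP[_ jk]; rewrite ltnS in jk.
  rewrite /F /exp_coeff /= -(bin_fact jk) !natrM.
  have {1}-> : t ^+ k = t ^+ j * t ^+ (k - j)%N by rewrite -exprD subnKC.
  have := fact_gt0 j; have := fact_gt0 (k - j)%N.
  have : (0 < 'C(k, j))%N by rewrite bin_gt0.
  rewrite -!(ltr0n R) => /lt0r_neq0 ? /lt0r_neq0 ? /lt0r_neq0 ?.
  rewrite exprMn; field; rewrite ?pnatr_eq0 //.
  by apply/and3P; split; rewrite // -(pnatr_eq0 R).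
elim: n => [|n IH]; first by rewrite !big_geq.
rewrite big_nat_recr //= IH [in RHS]big_nat_recr //= subSnn.
have -> : series (exp_coeff (t * y)) 1%N = exp_coeff (t * y) 0%N.
  by rewrite /series/= big_nat1.
rewrite [X in _ + X = _]big_nat_recr //= subnn addrA; congr (_ + _).
rewrite -big_split /= !big_nat; apply: eq_bigr => j /andP[_ jn].
by rewrite subSn 1?ltnW// seriesSr mulrDr.
Qed.

(** The identity (B + y)^(k+1) f = (B + y)^k (B f) + y (B + y)^k f, that is,
Pascal's rule. *)
Lemma binomial_transformS y b k : binomial_transform y b k.+1 =
  binomial_transform y (fun j => b j.+1) k + y * binomial_transform y b k.
Proof.
have -> : y * binomial_transform y b k =
    y ^+ k.+1 * b 0%N + \sum_(0 <= j < k.+1) 'C(k, j.+1)%:R * y ^+ (k - j) * b j.+1.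
  rewrite /binomial_transform mulr_sumr big_nat_recl//= [in RHS]big_nat_recr//=.
  rewrite (bin_small (ltnSn k)) !mul0r addr0 bin0 subn0 mul1r mulrA -exprS; congr (_ + _).
  rewrite !big_nat; apply: eq_bigr => j /andP[_ jk].
  by rewrite -(subnSK jk) exprS; ring.
rewrite {1}/binomial_transform big_nat_recl// bin0 subn0 mul1r addrCA; congr (_ + _).
rewrite -big_split; apply: eq_bigr => j _ /=.
by rewrite subSS binS natrD; ring.
Qed.

Lemma exprD_binomial_transform x y k :
  (x + y) ^+ k = binomial_transform y (fun j => x ^+ j) k.
Proof.
rewrite addrC exprDn /binomial_transform big_mkord; apply: eq_bigr => j _.
by rewrite -mulrA mulr_natl.
Qed.

Lemma cvg_exp_series x : series (exp_coeff x) @ \oo --> expR x.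
Proof. exact: is_cvg_series_exp_coeff. Qed.

Lemma exp_tail_le x n m : `|series (exp_coeff x) m - series (exp_coeff x) n| <=
  `|series (exp_coeff `|x|) m - series (exp_coeff `|x|) n|.
Proof.
wlog nm : m n / (n <= m)%N.
  by move=> h; case: (leqP n m) => [|/ltnW] ?; [|rewrite distrC [leRHS]distrC]; exact: h.
rewrite !sub_series_geq//.
rewrite [leRHS]ger0_norm; last by apply: sumr_ge0 => i _; apply: divr_ge0; rewrite ?exprn_ge0.
apply: le_trans (ler_norm_sum _ _ _) _; apply: ler_sum => i _.
by rewrite /exp_coeff /= normrM normrX [X in _ * X]ger0_norm.
Qed.

(** Termwise comparison of the tails. Unlike the left-hand side, the remainders on
the right are those of a series with nonnegative terms, whose total against
positive weights tends to 0 by [cvg_exp_cauchy_remainder]. *)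
Lemma exp_remainder_le x n : `|expR x - series (exp_coeff x) n| <=
  expR `|x| - series (exp_coeff `|x|) n.
Proof.
apply: (@ler_cvg_to _ \oo _ _ (fun m => `|series (exp_coeff x) m - series (exp_coeff x) n|)
  (fun m => series (exp_coeff `|x|) m - series (exp_coeff `|x|) n)).
- by apply: cvg_norm; apply: cvgB; [exact: cvg_exp_series|exact: cvg_cst].
- by apply: cvgB; [exact: cvg_exp_series|exact: cvg_cst].
- near=> m.
  apply: le_trans (exp_tail_le _ _ _) _; rewrite ger0_norm//.
  have nm : (n <= m)%N by near: m; exact: nbhs_infty_ge.
  by rewrite sub_series_geq//; apply: sumr_ge0 => i _; apply: divr_ge0; rewrite ?exprn_ge0.
Unshelve. all: by end_near.
Qed.

(** By the binomial theorem the sum is e_n(x) exp(y) - e_n(x + y), where e_n is the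
partial sum of the exponential series. *)
Lemma cvg_exp_cauchy_remainder x y :
  \sum_(0 <= j < n) x ^+ j / j`!%:R * (expR y - series (exp_coeff y) (n - j)%N)
    @[n --> \oo] --> (0 : R).
Proof.
have h n : \sum_(0 <= j < n) x ^+ j / j`!%:R * (expR y - series (exp_coeff y) (n - j)%N)
   = series (exp_coeff x) n * expR y - series (exp_coeff (x + y)) n.
  have := exp_sum_binomial_transform 1 y (fun j => x ^+ j) n.
  under eq_bigr do rewrite -exprD_binomial_transform expr1n mul1r mulrC.
  under [in X in _ = X -> _]eq_bigr do rewrite expr1n !mul1r [_^-1 * _]mulrC.
  rewrite -[LHS]/(series (exp_coeff (x + y)) n) => ->.
  rewrite /series /= mulr_suml -sumrB; apply: eq_bigr => j _.
  by rewrite mulrBr.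
rewrite (funext h).
have := cvgB (cvgMr_tmp (b := expR y) (@cvg_exp_series x))
  (@cvg_exp_series (x + y)).
by rewrite expRD subrr; apply.
Qed.

End exponential_series.

(** * Two scalar recursions *)

Section scalar_recursions.
Context {R : realType}.
Implicit Types (a b : nat -> R) (H q s E rho : R).

(** A contraction that only shows after N + 1 steps still gives a geometric rate;
the constant absorbs the at most N uncontracted steps. *)
Lemma geometric_decay a H q rho N : (forall n, 0 <= a n) -> 0 < rho <= H ->
  (forall n, a n.+1 <= H * a n) -> (forall n, a (N.+1 + n)%N <= q * a n) ->
  q <= rho ^+ N.+1 -> forall n, a n <= (H / rho) ^+ N.+1 * a 0%N * rho ^+ n.
Proof.
move=> a0 /andP[rho0 rhoH] aH aq qrho.
have H0 : 0 < H by apply: lt_le_trans rhoH.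
have D1 : 1 <= H / rho by rewrite ler_pdivlMr// mul1r.
elim/ltn_ind => n IH; have [nN|Nn] := ltnP n N.+1.
  have an : a n <= H ^+ n * a 0%N.
    elim: n {IH nN} => [|n IH]; first by rewrite mul1r.
    by apply: le_trans (aH n) _; rewrite exprS -mulrA ler_wpM2l// ltW.
  apply: le_trans an _; rewrite mulrAC ler_wpM2r//.
  rewrite -{1}(divfK (lt0r_neq0 rho0) H) exprMn ler_wpM2r ?exprn_ge0 ?(ltW rho0)//.
  by rewrite ler_weXn2l// ltnW.
rewrite -(subnKC Nn); apply: le_trans (aq _) _.
apply: le_trans (ler_wpM2r (a0 _) qrho) _; rewrite [rho ^+ (_ + _)]exprD mulrCA.
rewrite ler_wpM2l ?exprn_ge0 ?(ltW rho0)//; apply: IH.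
by rewrite ltn_subrL (leq_trans _ Nn).
Qed.

(** The forcing rho^n dominates because s < rho: E / (rho - s) is the amplitude of
the particular solution. *)
Lemma geometric_forcing b s E rho : 0 <= b 0%N -> 0 <= s < rho -> 0 <= E ->
  (forall n, b n.+1 <= s * b n + E * rho ^+ n) ->
  forall n, b n <= (b 0%N + E / (rho - s)) * rho ^+ n.
Proof.
move=> b0 /andP[s0 srho] E0 bE.
have d0 : 0 < rho - s by rewrite subr_gt0.
have rho0 : 0 < rho by apply: le_lt_trans srho.
elim=> [|n IH]; first by rewrite expr0 mulr1 lerDl divr_ge0// ltW.
apply: le_trans (bE n) _.
apply: (@le_trans _ _ (s * ((b 0%N + E / (rho - s)) * rho ^+ n) + E * rho ^+ n)).
  by rewrite lerD2r ler_wpM2l.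
rewrite mulrA -mulrDl exprS mulrA ler_wpM2r ?exprn_ge0 ?(ltW rho0)//.
have -> : s * (b 0%N + E / (rho - s)) + E = s * b 0%N + E / (rho - s) * rho.
  by field; rewrite lt0r_neq0.
by rewrite mulrDl lerD2r mulrC ler_wpM2l// ltW.
Qed.

End scalar_recursions.

(** * The norms of L^p and C_b *)

Section function_space_norms.
Context {d : measure_display} {R : realType} {Omega : metricMeasurableType d R}.
Context (mu : {measure set Omega -> \bar R}).
Context (open_meas : forall A : set Omega, open A -> measurable A).
Context (mu_fin : (mu [set: Omega] < +oo)%E).
Implicit Types (X : function_space R) (f g m : Omega -> R) (a c M : R).

Lemma continuous_measurable f : continuous f -> measurable_fun [set: Omega] f.
Proof.
move=> cf; apply: (measurability _ (RGenOInfty.measurableE R)) => //.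
move=> _ [_ [a ->] <-]; rewrite setTI; apply: open_meas.
by move/continuousP: cf; apply; exact: interval_open.
Qed.

Lemma fnorm_CbP f M : reflect (forall x, `|f x| <= M) (fnorm mu Cb f <= M%:E)%E.
Proof.
apply: (iffP idP) => [h x|h].
  by rewrite -lee_fin (le_trans _ h)//; apply: ereal_sup_ubound; exists x.
by apply: ge_ereal_sup => _ [x _ <-]; rewrite lee_fin.
Qed.

Lemma fnorm_ge0 X f : (0 <= fnorm mu X f)%E.
Proof.
case: X => [p p1|]; first exact: Lnorm_ge0.
by apply: (@le_trans _ _ `|f point|%:E); rewrite ?lee_fin//;
  apply: ereal_sup_ubound; exists point.
Qed.

Lemma in_space_measurable X f : in_space mu X f -> measurable_fun [set: Omega] f.
Proof.
case: X => [p p1|] /=; last by case=> + _; exact: continuous_measurable.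
by rewrite inE => /andP[]; rewrite inE.
Qed.

Lemma in_space_fnorm_lty X f : in_space mu X f -> (fnorm mu X f < +oo)%E.
Proof.
case: X => [p p1|] /=; first by rewrite inE => /andP[_]; rewrite inE.
by move=> [_ [M fM]]; apply: le_lt_trans (ltry M); exact/fnorm_CbP.
Qed.

Lemma in_space_lin X a f g : in_space mu X f -> in_space mu X g ->
  in_space mu X (fun x => a * f x + g x).
Proof.
case: X => [p p1|] /=.
  by move=> fX gX; have [_ /(_ a f g fX gX)] := Lfun_submod_closed mu p1.
move=> [cf [M fM]] [cg [N gN]]; split.
  by move=> x; apply: cvgD; [apply: cvgMl_tmp; exact: cf|exact: cg].
exists (`|a| * M + N) => x; rewrite (le_trans (ler_normD _ _))// lerD//.
by rewrite normrM ler_wpM2l.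
Qed.

Lemma Lnorm_le p f g : (1 <= p)%E ->
  measurable_fun [set: Omega] f -> measurable_fun [set: Omega] g ->
  (forall x, `|f x| <= `|g x|) -> ('N[mu]_p[EFin \o f] <= 'N[mu]_p[EFin \o g])%E.
Proof.
move=> p1 mf mg fg; rewrite unlock /Lnorm; case: p p1 => [p p1|_|//].
  have p0 : 0 < p by rewrite -lte_fin (lt_le_trans _ p1).
  rewrite gt0_ler_poweR ?invr_ge0 ?(ltW p0)//.
  - by rewrite in_itv/= leey integral_ge0// => x _; rewrite poweR_ge0.
  - by rewrite in_itv/= leey integral_ge0// => x _; rewrite poweR_ge0.
  apply: ge0_le_integral => //=.
  - apply/measurable_EFinP; apply: (measurableT_comp (measurable_powR _)).
    exact: measurableT_comp.
  - apply/measurable_EFinP; apply: (measurableT_comp (measurable_powR _)).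
    exact: measurableT_comp.
  - by move=> x _; rewrite lee_fin ge0_ler_powR ?nnegrE// ltW.
by case: ifPn => // _; apply: le_ess_sup; apply: nearW => x /=; rewrite lee_fin.
Qed.

Lemma LnormZ_fun p a f : (1 <= p)%E -> f \in Lfun mu p ->
  ('N[mu]_p[EFin \o (fun x => (a * f x)%R)] = `|a|%:E * 'N[mu]_p[EFin \o f])%E.
Proof. by move=> p1 fX; rewrite -(LnormZ (Lfun_Sub p1 fX)). Qed.

Lemma fnorm_lin X a f g : in_space mu X f -> in_space mu X g ->
  (fnorm mu X (fun x => (a * f x + g x)%R) <= `|a|%:E * fnorm mu X f + fnorm mu X g)%E.
Proof.
case: X => [p p1|].
  move=> /= fX gX; rewrite -LnormZ_fun//.
  apply: (eminkowski mu (f := fun x => a * f x) (g := g)) => //.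
    apply: measurable_funM => //; exact: (in_space_measurable (X := Lp p1)).
  exact: (in_space_measurable (X := Lp p1)).
move=> fX gX.
have /fineK ff : fnorm mu Cb f \is a fin_num.
  by rewrite ge0_fin_numE ?fnorm_ge0// in_space_fnorm_lty.
have /fineK gf : fnorm mu Cb g \is a fin_num.
  by rewrite ge0_fin_numE ?fnorm_ge0// in_space_fnorm_lty.
rewrite -ff -gf -EFinM -EFinD; apply/fnorm_CbP => x.
rewrite (le_trans (ler_normD _ _))// lerD//.
  rewrite normrM ler_wpM2l//; move: x; apply/fnorm_CbP; by rewrite ff.
by move: x; apply/fnorm_CbP; rewrite gf.
Qed.

Lemma in_space_cst X a : in_space mu X (cst a).
Proof.
case: X => [p p1|] /=; last by split; [move=> x; exact: cvg_cst|exists `|a|].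
rewrite inE; apply/andP; split; rewrite inE//= /finite_norm unlock.
case: p p1 => [p _|_|//].
  by rewrite poweR_lty//= integral_cst// lte_mul_pinfty ?lee_fin ?powR_ge0.
case: ifPn => // _; apply: le_lt_trans (ltry `|a|).
by apply/ess_supP; exact: nearW.
Qed.

Lemma fnorm_le_scale X c f g : 0 <= c -> in_space mu X f -> in_space mu X g ->
  (forall x, `|f x| <= c * `|g x|) -> (fnorm mu X f <= c%:E * fnorm mu X g)%E.
Proof.
move=> c0 fX gX fg; case: X fX gX => [p p1|] fX gX.
  rewrite /= -[c in leRHS]ger0_norm// -LnormZ_fun//; apply: Lnorm_le => //.
  - exact: in_space_measurable fX.
  - by apply: measurable_funM => //; exact: in_space_measurable gX.
  - by move=> x; rewrite normrM (ger0_norm c0).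
have /fineK gf : fnorm mu Cb g \is a fin_num.
  by rewrite ge0_fin_numE ?fnorm_ge0// in_space_fnorm_lty.
rewrite -gf -EFinM; apply/fnorm_CbP => x; rewrite (le_trans (fg x))// ler_wpM2l//.
by move: x; apply/fnorm_CbP; rewrite gf.
Qed.

Lemma in_space_mul X m f c : continuous m -> (forall x, `|m x| <= c) ->
  in_space mu X f -> in_space mu X (fun x => m x * f x).
Proof.
move=> cm mc; case: X => [p p1|] /=; last first.
  move=> [cf [M fM]]; split; first by move=> x; apply: cvgM; [exact: cm|exact: cf].
  by exists (c * M) => x; rewrite normrM ler_pM.
move=> fX; rewrite inE; apply/andP; split; rewrite inE/=.
  apply: measurable_funM; first exact: continuous_measurable.
  exact: (in_space_measurable (X := Lp p1)).
have c0 : 0 <= c by apply: le_trans (mc point).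
have mf : measurable_fun setT f by exact: (in_space_measurable (X := Lp p1)).
apply: le_lt_trans (_ : 'N[mu]_p[EFin \o (fun x => (c * f x)%R)] < _)%E.
  apply: Lnorm_le => //.
  - by apply: measurable_funM; first exact: continuous_measurable.
  - exact: measurable_funM.
  - by move=> x; rewrite !normrM (ger0_norm c0) ler_wpM2r.
rewrite LnormZ_fun// lte_mul_pinfty//.
exact: (in_space_fnorm_lty (X := Lp p1)).
Qed.

(** The measure is finite, so C_b is contained in every X, and by the next lemma
every X is contained in L^1. *)
Lemma in_space_Cb X f : in_space mu Cb f -> in_space mu X f.
Proof.
move=> [cf [M fM]].
by have := in_space_mul cf fM (in_space_cst X 1); under eq_fun do rewrite /= mulr1.
Qed.

Lemma in_space_Lfun1 X f : in_space mu X f -> f \in Lfun mu 1%E.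
Proof.
case: X => [p p1 /=|]; last exact: (@in_space_Cb (Lp (lexx 1%E))).
apply: Lfun_subset => //; rewrite ge0_fin_numE//.
Qed.

Lemma in_space_sum X (c : nat -> R) (F : nat -> Omega -> R) n :
  (forall j, in_space mu X (F j)) -> in_space mu X (fun x => \sum_(0 <= j < n) c j * F j x).
Proof.
move=> FX; elim: n => [|n IH].
  have := in_space_cst X 0; congr in_space; apply/funext => x.
  by rewrite big_geq.
have := in_space_lin (c n) (FX n) IH; congr in_space; apply/funext => x.
by rewrite big_nat_recr//= addrC.
Qed.

Lemma fnorm_sum X (c e : nat -> R) (F : nat -> Omega -> R) n :
  (forall j, in_space mu X (F j)) ->
  (forall j, (fnorm mu X (F j) <= (e j)%:E)%E) ->
  (fnorm mu X (fun x => (\sum_(0 <= j < n) c j * F j x)%R) <=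
   (\sum_(0 <= j < n) `|c j| * e j)%:E)%E.
Proof.
move=> FX Fe; elim: n => [|n IH].
  rewrite big_geq//; have cX := in_space_cst X 0.
  have := fnorm_le_scale (lexx 0) cX cX.
  rewrite mul0e (_ : (fun x => _) = cst 0); last first.
    by apply/funext => x; rewrite big_geq.
  by apply => x; rewrite mul0r normr0.
rewrite big_nat_recr//= addrC.
rewrite (_ : (fun x => _) = (fun x => c n * F n x + \sum_(0 <= j < n) c j * F j x)); last first.
  by apply/funext => x; rewrite big_nat_recr//= addrC.
apply: le_trans (fnorm_lin _ (FX n) (in_space_sum c n FX)) _.
by rewrite EFinD; apply: leeD => //; rewrite EFinM lee_wpmul2l// lee_fin.
Qed.

End function_space_norms.

(** * Equicontinuity from precompactness *)

Lemma metric_ball_open (R : realType) (T : metricType R) (x : T) (e : R) :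
  open (ball x e).
Proof.
rewrite openE => y; rewrite ballEmdist /= => xy; apply/nbhs_ballP.
exists (e - mdist x y); first by rewrite /= subr_gt0.
move=> z; rewrite !ballEmdist/= ltrBrDl; apply: le_lt_trans.
exact: metric_triangle.
Qed.

Section equicontinuity.
Context {R : realType} {T : topologicalType}.

(** The easy half of the theorem of Arzela and Ascoli. The closure of S is compact,
and the covering argument runs over it; a limit point is replaced by a nearby
member of S, which is continuous at x. *)
Lemma uniform_precompact_equicontinuous (S : set (T -> R)) :
  precompact (S : set {uniform T -> R}) -> (forall g, S g -> continuous g) ->
  forall x e, 0 < e -> \forall x' \near x, forall g, S g -> `|g x' - g x| < e.
Proof.
rewrite precompactE => /compact_near_coveringP Scov Scont x e e0.
have e50 : 0 < e / 5 by rewrite divr_gt0.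
have : \forall x' \near x, closure (S : set {uniform T -> R}) `<=`
    (fun g : {uniform T -> R} => `|g x' - g x| < e).
  apply: (Scov _ (nbhs x) (fun x' (g : {uniform T -> R}) => `|g x' - g x| < e)) => g Sg.
  pose U : set {uniform T -> R} := [set h : {uniform T -> R} | forall y, `|g y - h y| < e / 5].
  have gU : nbhs g U.
    apply/uniform_nbhs; exists [set ab : R * R | ball ab.1 (e / 5) ab.2].
    split; first exact: (entourage_ball R (PosNum e50)).
    by move=> h /= gh y; apply: gh; rewrite ?inE.
  have [g0 [Sg0 gg0]] := Sg U gU.
  have g0x : \forall x' \near x, `|g0 x - g0 x'| < e / 5.
    by have /cvgrPdist_lt/(_ _ e50) := Scont g0 Sg0 x.
  exists (U, [set x' | `|g0 x - g0 x'| < e / 5]); first by split.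
  move=> [h x'] /= [gh g0x'].
  have := gg0 x; have := gg0 x'; have := gh x; have := gh x'.
  rewrite !ltr_norml; move: g0x'; rewrite ltr_norml.
  move: (g x) (g x') (h x) (h x') (g0 x) (g0 x') => a b c a' b' c'.
  move=> /andP[? ?] /andP[? ?] /andP[? ?] /andP[? ?] /andP[? ?].
  by apply/andP; split; lra.
by apply: filterS => x' Sx' g Sg; apply: Sx'; exact: subset_closure.
Qed.

End equicontinuity.

(** * The kernel operator on L^1 *)

Section fubini_swap.
Context {d : measure_display} {R : realType} {Omega : measurableType d}.
Context (mu : {measure set Omega -> \bar R}).

(** A copy of mu that can carry the finiteness hypothesis as a structure, as the
Fubini theorem for sigma-finite measures expects. *)
Definition finite_copy of (mu [set: Omega] < +oo)%E : set Omega -> \bar R := mu.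

Context (mu_fin : (mu [set: Omega] < +oo)%E).

HB.instance Definition _ := Measure.copy (finite_copy mu_fin) mu.
HB.instance Definition _ := Measure_isFinite.Build _ _ _ (finite_copy mu_fin)
  (lty_fin_num_fun mu_fin).

Lemma Fubini_finite (f : Omega * Omega -> \bar R) :
  measurable_fun [set: Omega * Omega] f ->
  (\int[mu]_x \int[mu]_y `|f (x, y)| < +oo)%E ->
  (\int[mu]_x \int[mu]_y f (x, y) = \int[mu]_y \int[mu]_x f (x, y))%E.
Proof.
move=> mf fint; pose m : {finite_measure set Omega -> \bar R} := finite_copy mu_fin.
by apply: (@Fubini _ _ _ _ _ m m); exact/integrable12ltyP.
Qed.

End fubini_swap.

Section kernel_operator.
Context {d : measure_display} {R : realType} {Omega : metricMeasurableType d R}.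
Context (mu : {measure set Omega -> \bar R}).
Context (open_meas : forall A : set Omega, open A -> measurable A).
Context (mu_fin : (mu [set: Omega] < +oo)%E).
Context (J : Omega -> Omega -> R).
Context (Jmeas : measurable_fun [set: Omega * Omega] (fun z => J z.1 z.2)).
Context (Jge0 : forall x y, 0 <= J x y).
Context (Jsym : forall x y, J x y = J y x).
Context (hK : KJ_compact_L1_Cb mu J).
Implicit Types (f g m : Omega -> R) (a c : R).

Local Notation K := (KJ mu J).
Local Notation L1 := (Lfun mu 1%E).
Local Notation "'\I' f" := (\int[mu]_y f y) (at level 10, f at level 8).

Lemma L1_integrable f : f \in L1 -> mu.-integrable [set: Omega] (EFin \o f).
Proof. by move/Lfun1_integrable. Qed.

Lemma Cb_L1 f : in_space mu Cb f -> f \in L1.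
Proof. exact: in_space_Lfun1. Qed.

Lemma cst_L1 a : cst a \in L1.
Proof. by apply: Cb_L1; exact: in_space_cst. Qed.

Lemma L1_lin a f g : f \in L1 -> g \in L1 -> (fun x => a * f x + g x) \in L1.
Proof. exact: (in_space_lin (X := Lp (lexx 1%E))). Qed.

Lemma L1_mul_Cb m f : in_space mu Cb m -> f \in L1 -> (fun x => m x * f x) \in L1.
Proof. by move=> [cm [M mM]]; exact: (in_space_mul open_meas (X := Lp (lexx 1%E)) cm mM). Qed.

Lemma L1_measurable f : f \in L1 -> measurable_fun [set: Omega] f.
Proof. exact: (in_space_measurable open_meas (X := Lp (lexx 1%E)) (mu := mu)). Qed.

Lemma L1_norm f : f \in L1 -> (fun x => `|f x|) \in L1.
Proof. exact: Lfun_norm. Qed.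

Lemma Rintegral_lin a f g : f \in L1 -> g \in L1 ->
  \int[mu]_y (a * f y + g y) = a * (\I f) + \I g.
Proof.
move=> /L1_integrable fi /L1_integrable gi; rewrite RintegralD//=; first by rewrite RintegralZl.
exact: (integrableZl measurableT a fi).
Qed.

Lemma Lnorm1E f : f \in L1 -> ('N[mu]_1[EFin \o f] = (\int[mu]_y `|f y|)%:E)%E.
Proof.
move=> /L1_integrable fi; rewrite Lnorm1 /Rintegral fineK//=.
by apply: integrable_fin_num => //; exact: (integrable_abse fi).
Qed.

Lemma K_L1 f : f \in L1 -> K f \in L1.
Proof. by move=> fi; apply/Cb_L1/(KJ_Cb hK). Qed.

Lemma Jmul_L1 f x : f \in L1 -> (fun y => J x y * f y) \in L1.
Proof. by move=> fi; apply/Lfun1_integrable; exact: (KJ_defined hK fi x). Qed.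

Lemma J_L1 x : J x \in L1.
Proof. by have := Jmul_L1 x (cst_L1 1); under eq_fun do rewrite /= mulr1. Qed.

Lemma K_lin a f g x : f \in L1 -> g \in L1 ->
  K (fun y => a * f y + g y) x = a * K f x + K g x.
Proof.
move=> fi gi; rewrite /KJ -Rintegral_lin ?Jmul_L1//.
by apply: eq_Rintegral => y _; rewrite mulrDr mulrCA.
Qed.

Lemma K_cst a x : K (cst a) x = a * h0 mu J x.
Proof.
rewrite /KJ /h0; under eq_Rintegral do rewrite /= mulrC.
by rewrite RintegralZl// L1_integrable// J_L1.
Qed.

Lemma K_bound : exists2 C, 0 <= C &
  forall f x, f \in L1 -> `|K f x| <= C * \int[mu]_y `|f y|.
Proof.
have [C hC] := KJ_bounded hK; exists `|C| => // f x fi.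
have := hC f fi; rewrite Lnorm1E// -EFinM => /fnorm_CbP/(_ x)/le_trans; apply.
by rewrite ler_wpM2r ?ler_norm//; exact: Rintegral_ge0.
Qed.

Lemma K_ge0 f : (forall y, 0 <= f y) -> forall x, 0 <= K f x.
Proof. by move=> f0 x; apply: Rintegral_ge0 => y _; rewrite mulr_ge0. Qed.

Lemma h0_Cb : in_space mu Cb (h0 mu J).
Proof.
have := KJ_Cb hK (cst_L1 1); congr in_space; apply/funext => x.
by rewrite K_cst mul1r.
Qed.

(** The symmetry of J is inherited by K through Fubini; the integrability of
J(x, y) f(y) g(x) follows from the boundedness of K |f|. *)
Lemma K_sym f g : f \in L1 -> g \in L1 ->
  \int[mu]_x (K f x * g x) = \int[mu]_x (f x * K g x).
Proof.
move=> fi gi; pose F (z : Omega * Omega) := (J z.1 z.2 * f z.2 * g z.1)%:E.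
have mf : measurable_fun setT f by exact: L1_measurable.
have mg : measurable_fun setT g by exact: L1_measurable.
have EK h x : h \in L1 -> (\int[mu]_y (J x y * h y)%:E = (K h x)%:E)%E.
  move=> hi; rewrite /KJ /Rintegral fineK//; apply: integrable_fin_num => //.
  exact: L1_integrable (Jmul_L1 x hi).
have mF : measurable_fun [set: Omega * Omega] F.
  apply/measurable_EFinP/measurable_funM; last exact: measurableT_comp.
  by apply: measurable_funM => //; exact: measurableT_comp.
have inner h k x : h \in L1 -> (\int[mu]_y (J x y * h y * k)%:E = (K h x * k)%:E)%E.
  move=> hi; under eq_integral do rewrite EFinM.
  rewrite integralZr//; first by rewrite EK.
  exact: L1_integrable (Jmul_L1 x hi).
have Ffin : (\int[mu]_x \int[mu]_y `|F (x, y)| < +oo)%E.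
  under eq_integral => x _.
    under eq_integral => y _ do rewrite /F/= !normrM (ger0_norm (Jge0 _ _)).
    rewrite (inner (fun y => `|f y|)) ?L1_norm//; over.
  apply: integrable_lty => //.
  apply: (L1_integrable (f := fun x => K (fun y => `|f y|) x * `|g x|)).
  by apply: L1_mul_Cb; [apply: KJ_Cb hK _ _; exact: L1_norm|exact: L1_norm].
have swap := Fubini_finite mu_fin mF Ffin.
rewrite /Rintegral; congr fine; transitivity (\int[mu]_x \int[mu]_y F (x, y))%E.
  by apply: eq_integral => x _; rewrite /F/= inner.
rewrite swap; apply: eq_integral => y _; rewrite mulrC -inner//.
by apply: eq_integral => x _; rewrite /F/= Jsym mulrAC.
Qed.

Lemma Rintegral_K f : f \in L1 -> \I (K f) = \int[mu]_x (h0 mu J x * f x).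
Proof.
move=> fi; have := K_sym fi (cst_L1 1).
under eq_Rintegral do rewrite /= mulr1.
move=> ->; apply: eq_Rintegral => x _; by rewrite K_cst mul1r mulrC.
Qed.

Lemma Rintegral_gt0 f (W : set Omega) : f \in L1 -> (forall y, 0 <= f y) ->
  measurable W -> (0 < mu W)%E -> (forall y, W y -> 0 < f y) -> 0 < \I f.
Proof.
move=> fi f0 mW W0 fW; rewrite lt_neqAle Rintegral_ge0 ?andbT//.
apply/negP => /eqP I0; have fint := L1_integrable fi.
have fae : (\int[mu]_x `|(EFin \o f) x| = 0)%E.
  under eq_integral do rewrite /= ger0_norm//.
  by rewrite -[LHS]fineK ?integrable_fin_num// -/(Rintegral mu _ _) -I0.
have [N [mN N0 fN]] := (ae_eq_integral_abs mu measurableT (measurable_int _ fint)).1 fae.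
have : (mu W <= mu N)%E.
  rewrite le_measure ?inE// => y Wy; apply: fN => /(_ I) /= [] fy.
  by have := fW y Wy; rewrite fy ltxx.
by rewrite N0 leNgt W0.
Qed.

Lemma K_scale a f x : f \in L1 -> K (fun y => a * f y) x = a * K f x.
Proof.
move=> fi; rewrite /KJ -RintegralZl ?L1_integrable ?Jmul_L1//.
by apply: eq_Rintegral => y _; rewrite mulrCA.
Qed.

(** Precompactness concerns the image of the unit ball of L^1; homogeneity extends
the equicontinuity to a ball of any radius. *)
Lemma K_equicontinuous M x e : 0 < e -> \forall x' \near x,
  forall f, f \in L1 -> \int[mu]_y `|f y| <= M -> `|K f x' - K f x| < e.
Proof.
move=> e0; pose c := `|M| + 1.
have c0 : 0 < c by rewrite ltr_wpDl.
have Scont g : (KJ mu J @` [set f | f \in L1 /\ ('N[mu]_1[EFin \o f] <= 1)%E]) g ->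
    continuous g by move=> [f [fi _] <-]; have [] := KJ_Cb hK fi.
have := @uniform_precompact_equicontinuous _ _ _ (KJ_compact hK) Scont x _ (divr_gt0 e0 c0).
apply: filterS => x' h f fi fM.
have cfi : (fun y => c^-1 * f y) \in L1.
  by have := L1_lin c^-1 fi (cst_L1 0); under eq_fun do rewrite addr0.
have /h : (KJ mu J @` [set f | f \in L1 /\ ('N[mu]_1[EFin \o f] <= 1)%E])
    (K (fun y => c^-1 * f y)).
  exists (fun y => c^-1 * f y) => //; split=> //.
  rewrite Lnorm1E// lee_fin.
  have cn : `|c^-1| = c^-1 by rewrite gtr0_norm// invr_gt0.
  under eq_Rintegral do rewrite normrM cn.
  rewrite RintegralZl ?L1_integrable ?L1_norm// ler_pdivrMl// mulr1.
  by rewrite (le_trans fM)// /c (le_trans (ler_norm _))// lerDl.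
rewrite !K_scale// -mulrBr normrM gtr0_norm ?invr_gt0// [_ / _]mulrC.
by rewrite ltr_pM2l ?invr_gt0.
Qed.

(** * Iterated kernels and the Doeblin minorization *)

(** The integral kernel of the operator K^(n+1); see [iter_kernelE]. *)
Definition iter_kernel n x : Omega -> R := iter n K (J x).
Local Notation k := iter_kernel.

Lemma iterK_L1 n f : f \in L1 -> iter n K f \in L1.
Proof. by move=> fi; elim: n => //= n; exact: K_L1. Qed.

Lemma iterK_ge0 n f : (forall y, 0 <= f y) -> forall y, 0 <= iter n K f y.
Proof. by move=> f0; elim: n => //= n; exact: K_ge0. Qed.

Lemma iterK_sym n f g : f \in L1 -> g \in L1 ->
  \int[mu]_y (iter n K f y * g y) = \int[mu]_y (f y * iter n K g y).
Proof.
move=> fi; elim: n g => [//|n IH] g gi.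
by rewrite (iterSr n K g) -IH ?K_L1//= K_sym// iterK_L1.
Qed.

Lemma iter_kernelE n f x : f \in L1 ->
  iter n.+1 K f x = \int[mu]_y (k n x y * f y).
Proof. by move=> fi; rewrite iterK_sym// J_L1. Qed.

Lemma iter_kernel_sym n x z : k n x z = k n z x.
Proof.
case: n => [|n]; first exact: Jsym.
rewrite /k [LHS]iter_kernelE ?J_L1// /=; rewrite /KJ.
by apply: eq_Rintegral => y _; rewrite mulrC.
Qed.

Lemma iter_kernel_norm n : exists M, forall x, \int[mu]_y `|k n x y| <= M.
Proof.
have mu0 : 0 <= fine (mu setT) by rewrite fine_ge0.
elim: n => [|n [M hM]].
  have [_ [M hM]] := h0_Cb; exists M => x; apply: le_trans (hM x).
  rewrite (le_trans _ (ler_norm _))// /h0 le_eqVlt; apply/orP; left; apply/eqP.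
  by apply: eq_Rintegral => y _; rewrite ger0_norm.
have [C C0 hC] := K_bound; exists (C * M * fine (mu setT)) => x.
rewrite -Rintegral_cst//; apply: le_Rintegral => //.
- by apply/L1_integrable/L1_norm/iterK_L1/J_L1.
- exact: (L1_integrable (cst_L1 _)).
- move=> y _; apply: le_trans (hC _ y (iterK_L1 n (J_L1 x))) _.
  by rewrite ler_wpM2l//; exact: hM.
Qed.

(** The modulus of continuity is uniform in z because the functions k n z form a
bounded subset of L^1. *)
Lemma iter_kernel_equicontinuous n x e : 0 < e ->
  \forall x' \near x, forall z, `|k n.+1 z x' - k n.+1 z x| < e.
Proof.
move=> e0; have [M hM] := iter_kernel_norm n.
apply: filterS (@K_equicontinuous M x e e0) => x' h z.
exact: h (iterK_L1 n (J_L1 z)) (hM z).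
Qed.

(** Equicontinuity in the second variable, used in each variable in turn thanks
to the symmetry of the kernel. *)
Lemma iter_kernel_continuous n :
  continuous (fun p : Omega * Omega => k n.+1 p.1 p.2).
Proof.
move=> [x z]; apply/cvgrPdist_lt => e e0 /=.
have e20 : 0 < e / 2 by rewrite divr_gt0.
exists ([set x' | forall y, `|k n.+1 y x' - k n.+1 y x| < e / 2],
        [set z' | forall y, `|k n.+1 y z' - k n.+1 y z| < e / 2]).
  by split; exact: iter_kernel_equicontinuous.
move=> [x' z'] /= [hx hz].
have h1 : `|k n.+1 x z - k n.+1 x' z| < e / 2.
  by rewrite distrC (iter_kernel_sym _ x') (iter_kernel_sym _ x); exact: hx.
have h2 : `|k n.+1 x' z - k n.+1 x' z'| < e / 2 by rewrite distrC; exact: hz.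
rewrite [e]splitr; apply: le_lt_trans (ler_distD (k n.+1 x' z) _ _) _.
by rewrite ltrD.
Qed.

Context (ball_gt0 : forall (x : Omega) e, 0 < e -> (0 < mu (ball x e))%E).
Context (r : R) (r0 : 0 < r).
Context (Jpos : forall x y : Omega, mdist x y < r -> 0 < J x y).

Lemma iter_kernel_ge0 n x y : 0 <= k n x y.
Proof. exact: iterK_ge0. Qed.

Lemma open_gt0 (W : set Omega) y : open W -> W y -> (0 < mu W)%E.
Proof.
move=> oW Wy; have /nbhs_ballP[e /= e0 eW] : nbhs y W by exact: open_nbhs_nbhs.
apply: lt_le_trans (ball_gt0 y e0) _; rewrite le_measure// inE; apply: open_meas => //.
exact: metric_ball_open.
Qed.

(** The kernel k (n+2) x z integrates J(z, .) against k (n+1) x. The latter is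
continuous and positive at y, the former is positive on the ball of radius r
around z, which contains y; so both are positive on a nonempty open set. *)
Lemma iter_kernel_pos_step n x y z : 0 < k n.+1 x y -> mdist z y < r ->
  0 < k n.+2 x z.
Proof.
move=> kxy zy; pose W := [set y | 0 < k n.+1 x y] `&` ball z r.
have oW : open W.
  apply: openI; last exact: metric_ball_open.
  have kc : continuous (k n.+1 x) by have [] := KJ_Cb hK (iterK_L1 n (J_L1 x)).
  rewrite (_ : mkset _ = k n.+1 x @^-1` [set s | 0 < s])//.
  by apply: open_comp; [move=> ? _; exact: kc|exact: open_gt].
apply: (Rintegral_gt0 (W := W)).
- exact: Jmul_L1 z (iterK_L1 n.+1 (J_L1 x)).
- by move=> w; rewrite mulr_ge0//; exact: (iter_kernel_ge0 n.+1).
- exact: open_meas.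
- by apply: (open_gt0 (y := y)) => //; split => //; rewrite ballEmdist.
- by move=> w [kw]; rewrite ballEmdist => zw; rewrite mulr_gt0// Jpos.
Qed.

Lemma iter_kernel_diag_gt0 n x : 0 < k n.+1 x x.
Proof.
elim: n => [|n IH]; last by apply: iter_kernel_pos_step IH _; rewrite mdistxx.
apply: (Rintegral_gt0 (W := ball x r)).
- exact/Jmul_L1/J_L1.
- by move=> ?; rewrite mulr_ge0.
- exact/open_meas/metric_ball_open.
- exact: ball_gt0.
- by move=> w; rewrite ballEmdist => xw; rewrite mulr_gt0// Jpos.
Qed.

Context (chain : chain_connected Omega r).

(** Positivity at (x, z) persists: add the trivial step from z to z. *)
Lemma iter_kernel_gt0_mono (n m : nat) x z : (n <= m)%N ->
  0 < k n.+1 x z -> 0 < k m.+1 x z.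
Proof.
move=> /subnK <-; elim: (m - n)%N => [//|i IH] /IH kxz.
by apply: iter_kernel_pos_step kxz _; rewrite mdistxx.
Qed.

Lemma iter_kernel_chain_gt0 x z : exists n, 0 < k n.+1 x z.
Proof.
have [s [sp <-]] := chain x z.
suff along w : path (fun v v' => mdist v v' < r) w s ->
    (exists n, 0 < k n.+1 x w) -> exists n, 0 < k n.+1 x (last w s).
  by apply: along => //; exists 0%N; exact: iter_kernel_diag_gt0.
elim: s w {sp} => [|v s IH] w //= /andP[wv vs] [n hn].
apply: IH => //; exists n.+1.
by apply: iter_kernel_pos_step hn _; rewrite metric_sym.
Qed.

Context (cpt : compact [set: Omega]).

(** The open sets where k (n+1) is positive increase with n and cover the compact
square, so one of them is everything; there the minimum is attained. *)
Lemma iter_kernel_uniform_gt0 :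
  exists n, exists2 delta, 0 < delta & forall x z, delta <= k n.+1 x z.
Proof.
have cpt2 : compact [set: Omega * Omega] by rewrite -setXTT; exact: compact_setX.
have /compact_near_coveringP cov := cpt2.
have [n _ hn] : \forall n \near \oo, [set: Omega * Omega] `<=`
    (fun p => 0 < k n.+1 p.1 p.2).
  apply: (cov _ _ (fun n (p : Omega * Omega) => 0 < k n.+1 p.1 p.2)) => -[x z] _.
  have [n hn] := iter_kernel_chain_gt0 x z.
  exists ([set p | 0 < k n.+1 p.1 p.2], [set m | (n <= m)%N]).
    split; last by exists n.
    apply: (@iter_kernel_continuous n (x, z) [set s | 0 < s]).
    exact: (open_nbhs_nbhs (conj (@open_gt R 0) hn)).
  by move=> [p m] /= [hp nm]; exact: iter_kernel_gt0_mono nm hp.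
have [||p _ pmin] := @compact_EVT_min _ _ (fun p => k n.+1 p.1 p.2) _ _ cpt2.
- by exists (point, point).
- by apply: continuous_subspaceT; exact: iter_kernel_continuous.
exists n, (k n.+1 p.1 p.2); first exact: (hn n (leqnn n)).
by move=> x z; apply: (pmin (x, z)); rewrite inE.
Qed.

Lemma iterK_doeblin : exists n, exists2 delta, 0 < delta &
  forall f, f \in L1 -> (forall y, 0 <= f y) ->
  forall x, delta * \I f <= iter n.+1 K f x.
Proof.
have [n [delta d0 hd]] := iter_kernel_uniform_gt0; exists n.+1, delta => // f fi f0 x.
rewrite iter_kernelE// -RintegralZl ?L1_integrable//; apply: le_Rintegral => //.
- by have := L1_lin delta fi (cst_L1 0); under eq_fun do rewrite addr0; exact: L1_integrable.
- have kc := KJ_Cb hK (iterK_L1 n (J_L1 x)).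
  exact: (L1_integrable (L1_mul_Cb kc fi)).
- by move=> y _; rewrite ler_wpM2r.
Qed.

(** * The positive operator B and its spectral gap *)

Context (alpha H : R) (alpha0 : 0 < alpha).
Context (h0_gt : forall x, alpha < h0 mu J x) (h0_le : forall x, h0 mu J x <= H).

(** The generator K_J - h_0 I, translated by H I so as to become positive. *)
Definition shifted_op f x : R := K f x + (H - h0 mu J x) * f x.
Local Notation B := shifted_op.

Lemma shift_coef_Cb : in_space mu Cb (fun x => H - h0 mu J x).
Proof.
have := in_space_lin (-1) h0_Cb (in_space_cst mu_fin Cb H).
by congr in_space; apply/funext => x; rewrite /= mulN1r addrC.
Qed.

Lemma shift_coef_bound x : `|H - h0 mu J x| <= H - alpha.
Proof. by rewrite ger0_norm ?subr_ge0// lerD2l lerN2 ltW. Qed.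

Lemma shifted_in_space X f : in_space mu X f -> in_space mu X (B f).
Proof.
move=> fX; have fi := in_space_Lfun1 open_meas mu_fin fX.
have := in_space_lin 1 (in_space_Cb open_meas mu_fin X (KJ_Cb hK fi))
  (in_space_mul open_meas (proj1 shift_coef_Cb) shift_coef_bound fX).
by congr in_space; apply/funext => x; rewrite mul1r.
Qed.

Lemma shifted_L1 f : f \in L1 -> B f \in L1.
Proof. exact: (shifted_in_space (X := Lp (lexx 1%E))). Qed.

Lemma iter_shifted_in_space X n f : in_space mu X f -> in_space mu X (iter n B f).
Proof. by move=> fX; elim: n => //= n; exact: shifted_in_space. Qed.

Lemma iter_shifted_L1 n f : f \in L1 -> iter n B f \in L1.
Proof. exact: (iter_shifted_in_space (X := Lp (lexx 1%E))). Qed.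

Lemma shifted_lin a f g : f \in L1 -> g \in L1 ->
  B (fun y => a * f y + g y) = (fun y => a * B f y + B g y).
Proof.
by move=> fi gi; apply/funext => x; rewrite /shifted_op K_lin//; ring.
Qed.

Lemma iter_shifted_lin n a f g : f \in L1 -> g \in L1 ->
  iter n B (fun y => a * f y + g y) = (fun y => a * iter n B f y + iter n B g y).
Proof.
by move=> fi gi; elim: n => //= n ->; rewrite shifted_lin// iter_shifted_L1.
Qed.

Lemma K_le f g x : f \in L1 -> g \in L1 -> (forall y, f y <= g y) -> K f x <= K g x.
Proof.
move=> fi gi fg; apply: le_Rintegral => //; try exact/L1_integrable/Jmul_L1.
by move=> y _; rewrite ler_wpM2l.
Qed.

Lemma shifted_ge0 f : (forall y, 0 <= f y) -> forall y, 0 <= B f y.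
Proof.
by move=> f0 y; rewrite addr_ge0 ?K_ge0// mulr_ge0// subr_ge0.
Qed.

Lemma iter_shifted_ge0 n f : (forall y, 0 <= f y) -> forall y, 0 <= iter n B f y.
Proof. by move=> f0; elim: n => //= n; exact: shifted_ge0. Qed.

Lemma iterK_le_shifted n f x : f \in L1 -> (forall y, 0 <= f y) ->
  iter n K f x <= iter n B f x.
Proof.
move=> fi f0; elim: n x => //= n IH x.
apply: (@le_trans _ _ (K (iter n B f) x)).
  by apply: K_le => //; [exact: iterK_L1|exact: iter_shifted_L1].
by rewrite lerDl mulr_ge0 ?subr_ge0// iter_shifted_ge0.
Qed.

(** By symmetry K f and h_0 f have the same integral, so the generator preserves
integrals. *)
Lemma Rintegral_shifted f : f \in L1 -> \I (B f) = H * \I f.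
Proof.
move=> fi; have hf := L1_mul_Cb h0_Cb fi.
have -> : B f = (fun y => 1 * K f y + (H * f y + (-1 * (h0 mu J y * f y) + 0))).
  by apply/funext => y; rewrite /shifted_op; ring.
have z := cst_L1 0.
rewrite Rintegral_lin ?K_L1 ?L1_lin// Rintegral_lin ?L1_lin// Rintegral_lin//.
by rewrite Rintegral_K// Rintegral_cst//; ring.
Qed.

Lemma Rintegral_iter_shifted n f : f \in L1 -> \I (iter n B f) = H ^+ n * \I f.
Proof.
move=> fi; elim: n => [|n IH]; first by rewrite mul1r.
by rewrite iterS Rintegral_shifted ?iter_shifted_L1// IH exprS mulrA.
Qed.

Lemma shifted_norm_le f : f \in L1 ->
  \int[mu]_y `|B f y| <= H * \int[mu]_y `|f y|.
Proof.
move=> fi; rewrite -(Rintegral_shifted (f := fun y => `|f y|)) ?L1_norm//.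
apply: le_Rintegral => //.
- exact/L1_integrable/L1_norm/shifted_L1.
- exact/L1_integrable/shifted_L1/L1_norm.
move=> y _; apply: le_trans (ler_normD _ _) _; apply: lerD.
  have := le_normr_Rintegral measurableT (L1_integrable (Jmul_L1 y fi)).
  move/le_trans; apply; apply: le_Rintegral => //.
  - exact/L1_integrable/L1_norm/Jmul_L1.
  - exact/L1_integrable/Jmul_L1/L1_norm.
  - by move=> z _; rewrite normrM ger0_norm.
by rewrite normrM ger0_norm// subr_ge0.
Qed.

(** Both |f| + f and |f| - f are nonnegative with integral |f|_1, so B^(N+1)
of either is at least delta |f|_1; integrating
|B^(N+1) f| <= B^(N+1) |f| - delta |f|_1 gives q = H^(N+1) - delta mu(Omega). *)
Lemma shifted_contraction : exists N, exists2 q, q < H ^+ N.+1 &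
  forall f, f \in L1 -> \I f = 0 ->
  \int[mu]_y `|iter N.+1 B f y| <= q * \int[mu]_y `|f y|.
Proof.
have [N [delta d0 doeblin]] := iterK_doeblin.
exists N, (H ^+ N.+1 - delta * fine (mu setT)).
  rewrite ltrBlDr ltrDl mulr_gt0// fine_gt0// mu_fin andbT.
  exact: (@open_gt0 _ point openT).
move=> f fi f0; have nfi := L1_norm fi; set m := \int[mu]_y `|f y|.
have key a x : `|a| = 1 -> a * iter N.+1 B f x + delta * m <= iter N.+1 B (fun y => `|f y|) x.
  move=> a1; pose g y := (- a) * f y + `|f y|.
  have gi : g \in L1 by exact: L1_lin.
  have g0 y : 0 <= g y.
    rewrite /g addrC mulNr subr_ge0 (le_trans (ler_norm _))//.
    by rewrite normrM a1 mul1r.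
  have := le_trans (doeblin g gi g0 x) (iterK_le_shifted N.+1 x gi g0).
  rewrite /g Rintegral_lin// f0 mulr0 add0r iter_shifted_lin// -/m; lra.
have bound x : `|iter N.+1 B f x| <= iter N.+1 B (fun y => `|f y|) x - delta * m.
  rewrite ler_norml; apply/andP; split.
    by have := key (-1) x (normrN1 _); lra.
  by have := key 1 x (normr1 _); lra.
have Bi := iter_shifted_L1 N.+1 nfi; have ci := cst_L1 (- (delta * m)).
apply: (@le_trans _ _ (\int[mu]_x (1 * iter N.+1 B (fun y => `|f y|) x + cst (- (delta * m)) x))).
  apply: le_Rintegral => //.
  - exact/L1_integrable/L1_norm/iter_shifted_L1.
  - exact/L1_integrable/L1_lin.
  - by move=> x _; rewrite mul1r /=; exact: bound.
rewrite Rintegral_lin// Rintegral_cst// Rintegral_iter_shifted// -/m.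
by rewrite le_eqVlt; apply/orP; left; apply/eqP; ring.
Qed.

Lemma alpha_lt_H : alpha < H.
Proof. exact: lt_le_trans (h0_gt point) (h0_le point). Qed.

(** The rate rho lies above the (N+1)-th root of the contraction factor, so that it
serves in L^1, and above H - alpha, which the other norms require. *)
Lemma shifted_rate : exists2 rho, H - alpha < rho < H &
  forall f, f \in L1 -> \I f = 0 -> exists2 D, 0 <= D &
  forall n, \int[mu]_y `|iter n B f y| <= D * rho ^+ n.
Proof.
have [N [q qH contr]] := shifted_contraction.
have aH := alpha_lt_H; have H0 : 0 < H by apply: lt_trans aH.
(* The contraction factor q may be negative, hence has no root in general. *)
pose q' := Num.max q 0; have q'0 : 0 <= q' by rewrite le_max lexx orbT.
have q'H : q' < H ^+ N.+1 by rewrite gt_max qH exprn_gt0.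
pose rho1 := q' `^ (N.+1%:R)^-1.
have rho1E : rho1 ^+ N.+1 = q'.
  by rewrite -powR_mulrn ?powR_ge0// -powRrM mulVf ?pnatr_eq0// powRr1.
have rho1H : rho1 < H.
  by rewrite -(ltr_pXn2r (n := N.+1)) ?nnegrE ?powR_ge0 ?(ltW H0)// rho1E.
pose rho := (Num.max rho1 (H - alpha) + H) / 2.
have maxH : Num.max rho1 (H - alpha) < H by rewrite gt_max rho1H/= ltrBlDr ltrDl.
have rho1_le : rho1 <= Num.max rho1 (H - alpha) by rewrite le_max lexx.
have Ha_le : H - alpha <= Num.max rho1 (H - alpha) by rewrite le_max lexx orbT.
have rho1rho : rho1 <= rho by rewrite /rho; lra.
have arho : H - alpha < rho by rewrite /rho; lra.
have rhoH : rho < H by rewrite /rho; lra.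
have rho0 : 0 < rho by apply: lt_trans arho; rewrite subr_gt0.
exists rho; first by rewrite arho.
move=> f fi f0; exists ((H / rho) ^+ N.+1 * \int[mu]_y `|f y|).
  apply: mulr_ge0; last exact: Rintegral_ge0.
  apply: exprn_ge0; exact: divr_ge0 (ltW H0) (ltW rho0).
apply: (geometric_decay (a := fun n => \int[mu]_y `|iter n B f y|) (q := q')) => //.
- by move=> n; exact: Rintegral_ge0.
- by rewrite rho0 ltW.
- by move=> n; apply: shifted_norm_le; exact: iter_shifted_L1.
- move=> n; rewrite iterD.
  apply: le_trans (contr _ (iter_shifted_L1 n fi) _) _.
    by rewrite Rintegral_iter_shifted// f0 mulr0.
  by rewrite ler_wpM2r ?Rintegral_ge0// le_max lexx.
- by rewrite -rho1E lerXn2r ?nnegrE ?powR_ge0 ?(ltW rho0).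
Qed.

(** The norm of B g is at most (H - alpha) |g|_X plus a multiple of |g|_1, the
first term coming from the multiplication by H - h_0 and the second from the
smoothing K; the L^1 rate of the iterates is then inherited by |B^n f|_X. *)
Lemma shifted_rate_in_space X : exists2 rho, 0 < rho < H &
  forall f, in_space mu X f -> \I f = 0 -> exists2 D, 0 <= D &
  forall n, (fnorm mu X (iter n B f) <= (D * rho ^+ n)%:E)%E.
Proof.
have [rho /andP[arho rhoH] decay] := shifted_rate.
have aH := alpha_lt_H.
have rho0 : 0 < rho by apply: lt_trans arho; rewrite subr_gt0.
exists rho; first by rewrite rho0.
move=> f fX f0; have fi := in_space_Lfun1 open_meas mu_fin fX.
have [D D0 hD] := decay f fi f0.
have [C C0 hC] := K_bound.
have fin g : in_space mu X g -> (fine (fnorm mu X g))%:E = fnorm mu X g.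
  by move=> gX; rewrite fineK// ge0_fin_numE ?fnorm_ge0// in_space_fnorm_lty.
have cX := in_space_cst mu_fin X 1.
pose c1 := fine (fnorm mu X (cst 1)).
have c10 : 0 <= c1 by rewrite fine_ge0// fnorm_ge0.
pose b n := fine (fnorm mu X (iter n B f)).
have BX n := iter_shifted_in_space n fX.
have Bi n := iter_shifted_L1 n fi.
have step n : b n.+1 <= (H - alpha) * b n + C * D * c1 * rho ^+ n.
  have KX := in_space_Cb open_meas mu_fin X (KJ_Cb hK (Bi n)).
  have mX := in_space_mul open_meas (proj1 shift_coef_Cb) shift_coef_bound (BX n).
  have := fnorm_lin open_meas 1 KX mX.
  rewrite (_ : (fun x => _) = iter n.+1 B f); last first.
    by apply/funext => x; rewrite mul1r.
  rewrite normr1 mul1e -lee_fin fin// => /le_trans; apply.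
  rewrite EFinD addeC; apply: leeD; last first.
    rewrite EFinM fin//; apply: fnorm_le_scale => //; first by rewrite subr_ge0 ltW.
    by move=> x; rewrite normrM ler_wpM2r// shift_coef_bound.
  rewrite -mulrA [c1 * _]mulrC mulrA EFinM fin//.
  apply: fnorm_le_scale => //.
    by rewrite !mulr_ge0// exprn_ge0// ltW.
  move=> x; rewrite normr1 mulr1; apply: le_trans (hC _ x (Bi n)) _.
  by rewrite -mulrA ler_wpM2l.
exists (b 0%N + C * D * c1 / (rho - (H - alpha))).
  rewrite addr_ge0 ?fine_ge0 ?fnorm_ge0// divr_ge0 ?mulr_ge0//.
  by rewrite subr_ge0 ltW.
move=> n; rewrite -fin// lee_fin -/(b n).
apply: geometric_forcing => //.
- by rewrite fine_ge0// fnorm_ge0.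
- by rewrite subr_ge0 (ltW aH).
- by rewrite !mulr_ge0.
Qed.

(** * The exponential series of the generator *)

Local Notation A := (nonlocal_op mu J).

Lemma nonlocal_opE f : A f = (fun x => - H * f x + B f x).
Proof. by apply/funext => x; rewrite /nonlocal_op /shifted_op; ring. Qed.

Lemma nonlocal_in_space X f : in_space mu X f -> in_space mu X (A f).
Proof.
by move=> fX; rewrite nonlocal_opE; apply: in_space_lin => //; exact: shifted_in_space.
Qed.

Lemma iter_nonlocal_in_space X n f : in_space mu X f -> in_space mu X (iter n A f).
Proof. by move=> fX; elim: n => //= n; exact: nonlocal_in_space. Qed.

Lemma iter_nonlocal_lin n a f g : f \in L1 -> g \in L1 ->
  iter n A (fun y => a * f y + g y) = (fun y => a * iter n A f y + iter n A g y).
Proof.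
have L1X := iter_nonlocal_in_space (X := Lp (lexx 1%E)).
move=> fi gi; elim: n => //= n ->; apply/funext => x.
by rewrite /nonlocal_op K_lin//; [ring|exact: L1X|exact: L1X].
Qed.

Lemma nonlocal_cst a : A (cst a) = cst 0.
Proof. by apply/funext => x; rewrite /nonlocal_op K_cst /= mulrC subrr. Qed.

(** As A = B - H, this is the binomial theorem; the induction moves one factor B
from the operator to the argument, whence the shift of the sequence. *)
Lemma iter_nonlocalE n f x : f \in L1 ->
  iter n A f x = binomial_transform (- H) (fun j => iter j B f x) n.
Proof.
elim: n f => [|n IH] f fi; first by rewrite /binomial_transform big_nat1 /= bin0 !mul1r.
rewrite iterSr nonlocal_opE iter_nonlocal_lin ?shifted_L1//.
rewrite !IH ?shifted_L1// binomial_transformS addrC; congr (_ + _).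
by apply: eq_bigr => j _; rewrite -iterSr.
Qed.

Lemma exp_sum_nonlocalE t f n x : f \in L1 ->
  exp_sum A t f n x = \sum_(0 <= j < n)
    t ^+ j / j`!%:R * series (exp_coeff (- (t * H))) (n - j)%N * iter j B f x.
Proof.
move=> fi; rewrite /exp_sum -mulrN.
under eq_bigr do rewrite iter_nonlocalE//.
rewrite exp_sum_binomial_transform; apply: eq_bigr => j _.
by rewrite mulrAC.
Qed.


(** The coefficients e_(n-j)(- t H) may have either sign; each is bounded by its
limit exp(- t H) plus the remainder of the series of exp(t H). *)
Lemma exp_sum_fnorm_le X f D rho t n : in_space mu X f -> 0 <= t ->
  (forall j, (fnorm mu X (iter j B f) <= (D * rho ^+ j)%:E)%E) ->
  (fnorm mu X (exp_sum A t f n) <=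
   (D * (expR (- (t * H)) * series (exp_coeff (t * rho)) n +
     \sum_(0 <= j < n) (t * rho) ^+ j / j`!%:R *
       (expR (t * H) - series (exp_coeff (t * H)) (n - j)%N)))%:E)%E.
Proof.
move=> fX t0 hD; have fi := in_space_Lfun1 open_meas mu_fin fX.
have H0 : 0 <= H by apply/ltW/(lt_trans alpha0 alpha_lt_H).
have -> : exp_sum A t f n = fun x => \sum_(0 <= j < n)
    t ^+ j / j`!%:R * series (exp_coeff (- (t * H))) (n - j)%N * iter j B f x.
  by apply/funext => x; exact: exp_sum_nonlocalE.
apply: le_trans (fnorm_sum open_meas mu_fin _ n
  (fun j => iter_shifted_in_space j fX) hD) _.
have -> : series (exp_coeff (t * rho)) n = \sum_(0 <= j < n) exp_coeff (t * rho) j by [].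
rewrite lee_fin mulrDr !mulr_sumr -big_split/=; apply: ler_sum => j _.
have De : 0 <= D * rho ^+ j by rewrite -lee_fin (le_trans (fnorm_ge0 mu X _) (hD j)).
have coef0 : 0 <= t ^+ j / j`!%:R by rewrite divr_ge0 ?exprn_ge0.
rewrite normrM (ger0_norm coef0).
have := exp_remainder_le (- (t * H)) (n - j).
rewrite normrN (ger0_norm (mulr_ge0 t0 H0)).
set e := series (exp_coeff (- (t * H))) _; set e' := series (exp_coeff (t * H)) _.
move=> rem; have ebound : `|e| <= expR (- (t * H)) + (expR (t * H) - e').
  rewrite -[e](subrK (expR (- (t * H)))) addrC.
  apply: le_trans (ler_normD _ _) _.
  by rewrite ger0_norm ?expR_ge0// lerD2l distrC.
apply: (@le_trans _ _ (t ^+ j / j`!%:R *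
    (expR (- (t * H)) + (expR (t * H) - e')) * (D * rho ^+ j))).
  by rewrite ler_wpM2r// ler_wpM2l.
by rewrite /exp_coeff/= exprMn; rewrite le_eqVlt; apply/orP; left; apply/eqP; ring.
Qed.

Lemma mean_zero f : f \in L1 -> \int[mu]_y (-1 * cst (mean mu f) y + f y) = 0.
Proof.
move=> fi; rewrite Rintegral_lin ?cst_L1// Rintegral_cst// /mean.
have muT : fine (mu setT) != 0.
  by rewrite gt_eqF// fine_gt0// mu_fin andbT; exact: (@open_gt0 _ point openT).
by rewrite mulN1r mulrAC mulVf// mul1r addrC subrr.
Qed.

(** Constants are killed by A, hence fixed by its exponential; the term of index 0
must be present, hence n.+1. *)
Lemma exp_sum_sub_cst t f n x a : f \in L1 ->
  exp_sum A t f n.+1 x - a = exp_sum A t (fun y => -1 * cst a y + f y) n.+1 x.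
Proof.
move=> fi; have ai := cst_L1 a.
have iterA0 i : iter i.+1 A (cst a) = cst 0.
  by elim: i => [|i IH]; rewrite iterS ?IH nonlocal_cst.
rewrite /exp_sum !big_nat_recl// addrAC; congr (_ + _).
  by rewrite /= expr0 fact0 divr1; ring.
by apply: eq_bigr => i _; rewrite iter_nonlocal_lin// iterA0 /= mulr0 add0r.
Qed.

Lemma solution_decay X u0 (u : R -> Omega -> R) :
  in_space mu X u0 -> is_solution mu X J u0 u ->
  exists D, exists2 omega, 0 < omega & forall t, 0 <= t ->
    in_space mu X (fun x => u t x - mean mu u0) /\
    (fnorm mu X (fun x => (u t x - mean mu u0)%R) <= (D * expR (- (omega * t)))%:E)%E.
Proof.
move=> u0X hu; have u0i := in_space_Lfun1 open_meas mu_fin u0X.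
set m := mean mu u0; pose f y := -1 * cst m y + u0 y.
have fX : in_space mu X f by apply: in_space_lin => //; exact: in_space_cst.
have [rho /andP[rho0 rhoH] decay] := shifted_rate_in_space X.
have [D D0 hD] := decay f fX (mean_zero u0i).
exists D, (H - rho); first by rewrite subr_gt0.
move=> t t0; have [utX conv] := hu t t0.
have utmX : in_space mu X (fun x => u t x - m).
  have := in_space_lin (-1) (in_space_cst mu_fin X m) utX.
  by congr in_space; apply/funext => x; rewrite mulN1r addrC.
split=> //.
pose bnd n := D * (expR (- (t * H)) * series (exp_coeff (t * rho)) n +
     \sum_(0 <= j < n) (t * rho) ^+ j / j`!%:R *
       (expR (t * H) - series (exp_coeff (t * H)) (n - j)%N)).
pose err n := fnorm mu X (fun x => u t x - exp_sum A t u0 n x).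
have le n : (fnorm mu X (fun x => (u t x - m)%R) <= err n.+1 + (bnd n.+1)%:E)%E.
  have eX g i : in_space mu X g -> in_space mu X (exp_sum A t g i).
    by move=> gX; apply: in_space_sum => // j; exact: iter_nonlocal_in_space.
  have dX : in_space mu X (fun x => u t x - exp_sum A t u0 n.+1 x).
    have := in_space_lin (-1) (eX u0 n.+1 u0X) utX.
    by congr in_space; apply/funext => x; rewrite mulN1r addrC.
  have := fnorm_lin open_meas 1 dX (eX f n.+1 fX).
  rewrite normr1 mul1e (_ : (fun x => _) = (fun x => u t x - m)); last first.
    apply/funext => x; rewrite -exp_sum_sub_cst//; ring.
  by move/le_trans; apply; apply: leeD => //; exact: exp_sum_fnorm_le.
have bnd_cvg : bnd n @[n --> \oo] --> D * expR (- ((H - rho) * t)).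
  have -> : D * expR (- ((H - rho) * t)) = D * (expR (- (t * H)) * expR (t * rho) + 0).
    by rewrite addr0 -expRD; congr (_ * expR _); ring.
  apply: cvgMl_tmp; apply: cvgD; last exact: cvg_exp_cauchy_remainder.
  by apply: cvgMl_tmp; exact: cvg_exp_series.
have sum_cvg : (err n + (bnd n)%:E)%E @[n --> \oo] --> (D * expR (- ((H - rho) * t)))%:E.
  rewrite -[X in _ --> X]add0e; apply: cvgeD => //.
  by apply: cvg_EFin; [exact: nearW|exact: bnd_cvg].
apply: cvge_to_ge sum_cvg _; exists 1%N => // -[//|n] _; exact: le.
Qed.

End kernel_operator.

(** * Convergence to the mean *)

Theorem proposition4p9 (R : realType) (d : measure_display)
  (Omega : metricMeasurableType d R) (mu : {measure set Omega -> \bar R})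
  (X : function_space R) (J : Omega -> Omega -> R) (r alpha : R)
  (u0 : Omega -> R) (u : R -> Omega -> R)
  (hOmega : metric_measure_space mu)
  (hcompact : compact [set: Omega])
  (hfinite : (mu [set: Omega] < +oo)%E)
  (hJmeas : measurable_fun [set: Omega * Omega] (fun z => J z.1 z.2))
  (hJge0 : forall x y, 0 <= J x y)
  (hK : KJ_compact_L1_Cb mu J)
  (hJL : in_Linfty_L1 mu J)
  (hJsym : forall x y, J x y = J y x)
  (hr : 0 < r)
  (hJpos : forall x y : Omega, mdist x y < r -> 0 < J x y)
  (hchain : chain_connected Omega r)
  (halpha : 0 < alpha)
  (hh0 : forall x, alpha < h0 mu J x)
  (hu0 : in_space mu X u0)
  (hu : is_solution mu X J u0 u) :
  exists2 beta : R, 0 < beta &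
    fnorm mu X (fun x => expR (beta * t) * (u t x - mean mu u0))
      @[t --> +oo] --> 0%E.
Proof.
have open_meas := borel_measurable hOmega.
have ball_gt0 (x : Omega) e (e0 : 0 < e) : (0 < mu (ball x e))%E.
  by have /andP[] := ball_measure hOmega x e0.
have [_ [H hH]] := h0_Cb open_meas hfinite hK.
have h0_le x : h0 mu J x <= H by apply: le_trans (hH x); exact: ler_norm.
have [D [omega omega0 decay]] := solution_decay open_meas hfinite hJmeas hJge0 hJsym
  hK ball_gt0 hr hJpos hchain hcompact halpha hh0 h0_le hu0 hu.
have beta0 : 0 < omega / 2 by rewrite divr_gt0.
(* Half of the decay rate is spent on the weight, half is left for the limit. *)
exists (omega / 2) => //.
have cvg0 : (D * expR (- (omega / 2 * t)))%:E @[t --> +oo] --> (0 : R)%:E.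
  apply: cvg_EFin; first exact: nearW.
  rewrite -(mulr0 D); apply: cvgMl_tmp.
  by apply: (cvg_comp _ (fun s => expR (- s)) (gt0_cvgMry beta0 cvg_id) (@cvgr_expR R)).
apply: squeeze_cvge (cvg_cst _) cvg0.
near=> t; have t0 : 0 <= t by near: t; exact: nbhs_pinfty_ge.
have [utX hut] := decay t t0; rewrite fnorm_ge0/=.
have eX : in_space mu X (fun x => expR (omega / 2 * t) * (u t x - mean mu u0)).
  have := in_space_lin (expR (omega / 2 * t)) utX (in_space_cst hfinite X 0).
  by congr in_space; apply/funext => x; rewrite addr0.
apply: le_trans (fnorm_le_scale open_meas (expR_ge0 (omega / 2 * t)) eX utX _) _.
  by move=> x; rewrite normrM ger0_norm ?expR_ge0.
apply: le_trans (lee_wpmul2l _ hut) _; first by rewrite lee_fin expR_ge0.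
rewrite -EFinM mulrCA -expRD lee_fin le_eqVlt.
by apply/orP; left; apply/eqP; congr (_ * expR _); field.
Unshelve. all: by end_near.
Qed.
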